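(* For an unordered alphabet (letters may only be compared for equality), there exists an online algorithm that detects squares in $O(n\log n)$ time and $O(n)$ space, where $n$ is the length of the input string.
   Context: A square is a string $xx$ with $x$ nonempty; a string is squarefree if none of its substrings is a square. An algorithm detects squares in $O(f(n))$ time if for every $n$ and every input string of length $n$ it decides whether the string is squarefree using $O(f(n))$ operations. It detects squares online if it reads the input string letter by letter from left to right and, immediately after reading the last letter of each prefix, decides whether that prefix is squarefree (equivalently, it detects the first occurrence of a square). *)

(* Defs.v *)
From mathcomp Require Import all_boot.

Set Implicit Arguments.
Unset Strict Implicit.
Unset Printing Implicit Defensive.

Definition square (A : eqType) (u : seq A) : Prop :=
  exists x : seq A, x != [::] /\ u = x ++ x.

Definition squarefree (A : eqType) (s : seq A) : Prop :=
  forall u : seq A, infix u s -> ~ square u.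

Definition bigO (f g : nat -> nat) : Prop :=
  exists C n0 : nat, forall n, n0 <= n -> f n <= C * g n.

(** Algorithms are programs for a word RAM. The machine has an integer memory
    and a letter memory. Letters are opaque: a program can read the incoming
    one, copy them, and test two stored ones for equality, nothing else; its
    syntax does not mention the alphabet. *)

Inductive binop := OpAdd | OpSub | OpMul | OpDiv | OpMod | OpLt | OpEq.

Definition binop_sem (o : binop) (x y : nat) : nat :=
  match o with
  | OpAdd => x + y
  | OpSub => x - y
  | OpMul => x * y
  | OpDiv => x %/ y
  | OpMod => x %% y
  | OpLt => x < y
  | OpEq => x == y
  end.

Inductive expr :=
  | EConst of nat
  | EFetch of expr
  | EBin of binop & expr & expr
  | ELetterEq of expr & expr. (* the arguments are letter-memory addresses *)

Inductive cmd :=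
  | CSkip
  | CStore of expr & expr      (* integer cell at address e1 := value of e2 *)
  | CRead of expr              (* letter cell at address e := current letter *)
  | CCopyLetter of expr & expr (* letter cell at e1 := letter cell at e2 *)
  | CSeq of cmd & cmd
  | CIf of expr & cmd & cmd
  | CWhile of expr & cmd.

(** One time unit per operation of an expression. *)
Fixpoint ecost (e : expr) : nat :=
  match e with
  | EConst _ => 1
  | EFetch e1 => (ecost e1).+1
  | EBin _ e1 e2 => (ecost e1 + ecost e2).+1
  | ELetterEq e1 e2 => (ecost e1 + ecost e2).+1
  end.

Record state (A : Type) := State {
  words : nat -> nat;
  letters : nat -> option A (* [None]: nothing stored yet *)
}.

Definition init_state (A : Type) : state A := State (fun _ => 0) (fun _ => None).

Definition upd (T : Type) (f : nat -> T) (i : nat) (v : T) : nat -> T :=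
  fun j => if j == i then v else f j.

Section Machine.

Variables (A : eqType).
(** Each of the two memories consists of the [space] cells with addresses
    [0, ..., space - 1], and an integer cell holds [bits] bits. Leaving these
    bounds (or using an empty letter cell) is an error: evaluation yields
    [None], and execution is stuck. *)
Variables (space bits : nat).

Definition fit (v : nat) : option nat := if v < 2 ^ bits then Some v else None.

Definition fetch_word (st : state A) (i : nat) : option nat :=
  if i < space then Some (words st i) else None.

Definition fetch_letter (st : state A) (i : nat) : option A :=
  if i < space then letters st i else None.

Fixpoint eval (st : state A) (e : expr) : option nat :=
  match e with
  | EConst c => fit c
  | EFetch e1 => obind (fetch_word st) (eval st e1)
  | EBin o e1 e2 =>
      if (eval st e1, eval st e2) is (Some x, Some y)
      then fit (binop_sem o x y) else None
  | ELetterEq e1 e2 =>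
      if (obind (fetch_letter st) (eval st e1),
          obind (fetch_letter st) (eval st e2)) is (Some a, Some b)
      then fit (a == b) else None
  end.

(** [exec a c st t st']: with current input letter [a], command [c] started in
    [st] terminates without error in [st'] after [t] time units. *)
Inductive exec (a : A) : cmd -> state A -> nat -> state A -> Prop :=
  | exec_Skip st : exec a CSkip st 1 st
  | exec_Store e1 e2 st i v :
      eval st e1 = Some i -> i < space -> eval st e2 = Some v ->
      exec a (CStore e1 e2) st (ecost e1 + ecost e2).+1
        (State (upd (words st) i v) (letters st))
  | exec_Read e st i :
      eval st e = Some i -> i < space ->
      exec a (CRead e) st (ecost e).+1
        (State (words st) (upd (letters st) i (Some a)))
  | exec_CopyLetter e1 e2 st i b :
      eval st e1 = Some i -> i < space ->
      obind (fetch_letter st) (eval st e2) = Some b ->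
      exec a (CCopyLetter e1 e2) st (ecost e1 + ecost e2).+1
        (State (words st) (upd (letters st) i (Some b)))
  | exec_Seq c1 c2 st t1 st1 t2 st2 :
      exec a c1 st t1 st1 -> exec a c2 st1 t2 st2 ->
      exec a (CSeq c1 c2) st (t1 + t2) st2
  | exec_If e c1 c2 st v t st1 :
      eval st e = Some v -> exec a (if v != 0 then c1 else c2) st t st1 ->
      exec a (CIf e c1 c2) st (ecost e + t).+1 st1
  | exec_While_end e c st :
      eval st e = Some 0 -> exec a (CWhile e c) st (ecost e).+1 st
  | exec_While_loop e c st v t1 st1 t2 st2 :
      eval st e = Some v -> v != 0 ->
      exec a c st t1 st1 -> exec a (CWhile e c) st1 t2 st2 ->
      exec a (CWhile e c) st (ecost e + t1 + t2).+1 st2.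

(** An online algorithm is a single program, executed once per input letter on
    a persistent memory; the later letters are not available to it. When it
    halts, its verdict on the prefix read so far is whether integer cell 0 is
    nonzero. [run p st s t vs]: processing the letters of [s] from [st] takes
    [t] time units in total and produces the successive verdicts [vs]. *)
Inductive run (p : cmd) : state A -> seq A -> nat -> seq bool -> Prop :=
  | run_nil st : run p st [::] 0 [::]
  | run_cons st a s t st1 ts vs :
      exec a p st t st1 -> run p st1 s ts vs ->
      run p st (a :: s) (t + ts) ((words st1 0 != 0) :: vs).

Lemma exec_det a c st t1 st1 : exec a c st t1 st1 ->
  forall t2 st2, exec a c st t2 st2 -> t1 = t2 /\ st1 = st2.
Proof.
elim=> {c st t1 st1}.
- by move=> st t2 st2 E; inversion E; subst.
- move=> e1 e2 st i v E1 _ E2 t2 st2 E; inversion E; subst.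
  by split=> //; congruence.
- by move=> e st i E1 _ t2 st2 E; inversion E; subst; split=> //; congruence.
- move=> e1 e2 st i b E1 _ E2 t2 st2 E; inversion E; subst.
  by split=> //; congruence.
- move=> c1 c2 st t1 st1 t2 st2 _ IH1 _ IH2 t st' E.
  inversion E as [| | | |? ? ? ? ? ? ? R1 R2| | |]; subst.
  have [-> e] := IH1 _ _ R1; subst.
  by have [-> ->] := IH2 _ _ R2.
- move=> e c1 c2 st v t st1 E1 _ IH t2 st2 E.
  inversion E as [| | | | |? ? ? ? v' ? ? E2 R| |]; subst.
  have e0 : v = v' by congruence.
  by subst; have [-> ->] := IH _ _ R.
- move=> e c st E1 t2 st2 E.
  inversion E as [| | | | | | |? ? ? v ? ? ? ? E2 nz]; subst => //.
  by move: E2 nz; rewrite E1 => -[<-].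
- move=> e c st v t1 st1 t2 st2 E1 nz _ IH1 _ IH2 t st' E.
  inversion E as [| | | | | |? ? ? E2|? ? ? ? ? ? ? ? E2 _ R1 R2]; subst.
    by move: nz E2; rewrite E1 => /[swap] -[->].
  have [-> e0] := IH1 _ _ R1; subst.
  by have [-> ->] := IH2 _ _ R2.
Qed.

Lemma run_det p st s t1 vs1 : run p st s t1 vs1 ->
  forall t2 vs2, run p st s t2 vs2 -> t1 = t2 /\ vs1 = vs2.
Proof.
elim=> {st s t1 vs1} [st|st a s t st1 ts vs E _ IH] t2 vs2 R.
  by inversion R.
inversion R as [|? ? ? ? ? ? ? E' R']; subst.
have [-> e] := exec_det E E'; subst.
by have [-> ->] := IH _ _ R'.
Qed.

End Machine.

(* Main.v *)
(** Let [x x] be the first square, of period [p], and let [b] be the power of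
    two with [2 b <= p + 1 < 4 b]. Then [x] contains a block of length [b]
    whose position [i] is a multiple of [b], and the first such block starts
    less than [b] letters after the square; its copy starts at [i + p]. For each
    block and each half (of length [b]) of the range of [p], one task looks for
    that copy and extends the match of the two blocks in both directions until
    it covers a period. Since the text was squarefree so far, no failure
    function is needed: if [m < b] letters matched when the copy starts, they
    would recur there at once and form a square. Hence the naive matcher that
    never backs up in the text finds the copy. The left extension is done one
    letter at a time, while the block itself is being matched, so a task takes
    constant time per letter; at any time 11 tasks per power of two are active.
    This gives [O(log n)] operations per letter, in the worst case. *)

Require Import Defs.
From mathcomp Require Import all_boot zify.

Set Implicit Arguments.
Unset Strict Implicit.
Unset Printing Implicit Defensive.

(** * Squares by position and period *)

Definition square_at (E : eqType) (T : nat -> E) (i p : nat) : Prop :=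
  0 < p /\ forall x, x < p -> T (i + x) = T (i + p + x).

Definition square_before (E : eqType) (T : nat -> E) (N : nat) : Prop :=
  exists i p, square_at T i p /\ i + p + p <= N.

Lemma onth_take (E : Type) (s : seq E) (N k : nat) :
  onth (take N s) k = if k < N then onth s k else None.
Proof.
by elim: s N k => [|a s IH] [|N] [|k] //=; rewrite ?if_same ?ltnS //.
Qed.

Lemma onth_drop (E : Type) (s : seq E) (N k : nat) :
  onth (drop N s) k = onth s (N + k).
Proof. by elim: s N k => [|a s IH] [|N] k //=; case: k. Qed.

(** The bound [N <= size s] matters: past the end [onth s] is constantly [None], which would look
    like squares. *)
Lemma squarefree_takeP (A : eqType) (s : seq A) (N : nat) : N <= size s ->
  squarefree (take N s) <-> ~ square_before (onth s) N.
Proof.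
move=> leN; split=> [sqf [i [p [[p_gt0 eqx] leNp]]] | nosq u /infixP[s1 [s2 e]]].
  pose x := take p (drop i s).
  have szx : size x = p by rewrite size_takel // size_drop; lia.
  apply: (sqf (x ++ x)); last first.
    by exists x; split=> //; rewrite -size_eq0 szx -lt0n.
  have -> : x ++ x = take (p + p) (drop i (take N s)).
    apply: eq_from_onth => k; rewrite onth_cat szx !onth_take !onth_drop onth_take.
    case: (ltnP k p) => [ltkp|lepk].
      by do 2?case: ifP => ? //; lia.
    case: (ltnP k (p + p)) => [ltk|lek]; last by case: ifP => ? //; lia.
    rewrite !ifT; try lia.
    by rewrite eqx; [congr onth; lia | lia].
  exact: infix_trans (infix_take _ _) (infix_drop _ _).
case=> x [x0 eu]; apply: nosq; exists (size s1), (size x); split.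
  split=> [|k ltk]; first by rewrite lt0n size_eq0.
  have es : s = s1 ++ (x ++ x) ++ (s2 ++ drop N s).
    by rewrite -eu -{1}(cat_take_drop N s) e !catA.
  rewrite es !onth_cat !size_cat.
  do 6?case: ifP => ?; try lia.
  by congr onth; lia.
have := congr1 size e; rewrite size_takel // eu !size_cat; lia.
Qed.

(** The state [(m, l)] after [N] letters: the last [m] letters match the [m]
    letters from position [i] on, and the match extends [l] letters to the left
    of both occurrences. *)
Fixpoint track (E : eqType) (T : nat -> E) (i st N : nat) : nat * nat :=
  if N is n.+1 then
    let: (m, l) := track T i st n in
    if (st <= n) && (T n == T (i + m)) then
      (m + 1, l + (l == m) * ((m < i) * (T (i - (m + 1)) == T (n - m - (m + 1)))))
    else (0, 0)
  else (0, 0).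

(** The period is [N - m - i]. *)
Definition hit (i N : nat) (ml : nat * nat) : bool :=
  N - ml.1 <= ml.2 + ml.1 + i.

(** * Soundness and completeness of the matcher *)

Section Track.

Variables (E : eqType) (T : nat -> E).

(** Before its start a task is in the state [(0, 0)], which untouched memory already holds. *)
Lemma track_idle i st N : N <= st -> track T i st N = (0, 0).
Proof.
by elim: N => //= n IH ltn; rewrite (IH (ltnW ltn)) leqNgt ltn.
Qed.

(** One letter to the left is tested per letter matched on the right, and [l] stops growing at the
    first failure because [l == m] is then lost; hence [l <= m]. *)
Lemma track_sound i st N : i < st -> let: (m, l) := track T i st N in
  [/\ (m == 0) || (m + st <= N), l <= m, l <= i,
      forall x, x < m -> T (i + x) = T (N - m + x) &
      forall x, x < l -> T (i - x.+1) = T (N - m - x.+1)].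
Proof.
move=> ltist; elim: N => [|n] /=; first by split.
case: (track T i st n) => m l [lem lelm leli eqr eql].
case: ifP => [/andP[lestn /eqP en] | _]; last by split.
have le_mn : m + st <= n by case/orP: lem => [/eqP->|//].
(* The start [n - m] of the copy does not move, so earlier equalities carry over. *)
have eN : n.+1 - (m + 1) = n - m by lia.
rewrite eN; split; [lia | by case: (_ == _ :> E); lia.. | |].
- move=> x; rewrite addn1 ltnS leq_eqVlt => /orP[/eqP->|ltx]; last exact: eqr.
  by rewrite -en; congr T; lia.
- case: (eqVneq l m) => [elm|_] /=; last by move=> x; rewrite mul0n addn0; apply: eql.
  case: (ltnP m i) => /= [ltmi|_]; last by move=> x; rewrite muln0 addn0; apply: eql.
  case: eqP => /= [e1|_]; last by move=> x; rewrite muln0 addn0; apply: eql.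
  move=> x; rewrite !mul1n addn1 ltnS leq_eqVlt => /orP[/eqP->|ltx]; last exact: eql.
  by rewrite elm -(addn1 m).
Qed.

(** At distance [p = N - m - i] the text agrees on [l + m] consecutive positions from [i - l] on; a
    hit says [p <= l + m]. *)
Lemma hit_square i st N : i < st -> st <= N ->
  hit i N (track T i st N) -> square_before T N.
Proof.
move=> ltist lestN; have := track_sound N ltist; rewrite /hit.
case: (track T i st N) => m l [lem lelm leli eqr eql] /= hitN.
have le_mN : m + st <= N by case/orP: lem => [/eqP->|].
exists (i - l), (N - m - i); split; last by lia.
split=> [|x ltx]; first by lia.
case: (ltnP x l) => [ltxl|lelx].
  have := eql (l - x.+1) ltac:(lia).
  have -> : i - (l - x.+1).+1 = i - l + x by lia.
  by have -> : N - m - (l - x.+1).+1 = i - l + (N - m - i) + x by lia.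
have := eqr (x - l) ltac:(lia).
have -> : i + (x - l) = i - l + x by lia.
by have -> : N - m + (x - l) = i - l + (N - m - i) + x by lia.
Qed.

(* When the copy of the block starts, the automaton has no match in progress:
   its m matched letters would recur at once, since m < b, and form a square
   of period m that ends before the square of period p does. *)
Lemma square_hit s0 p i b st : square_at T s0 p ->
  ~ square_before T (s0 + p + p).-1 ->
  s0 <= i < s0 + b -> i < st -> st <= i + p < st + b -> i + b <= s0 + p ->
  hit i (s0 + p + p) (track T i st (s0 + p + p)).
Proof.
move=> [p_gt0 sq] nosq ibd ltist jbd ibs.
have sqj x : x < s0 + p - i -> T (i + x) = T (i + p + x).
  move=> ltx; have := sq (i - s0 + x) ltac:(lia).
  have -> : s0 + (i - s0 + x) = i + x by lia.
  by have -> : s0 + p + (i - s0 + x) = i + p + x by lia.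
have start : track T i st (i + p) = (0, 0).
  have := track_sound (i + p) ltist.
  case: (track T i st (i + p)) => m l [lem lelm leli eqr eql].
  case: (posnP m) => [m0|m_gt0]; first by congr pair; lia.
  case: nosq; exists (i + p - m), m; split; last by lia.
  split=> // x ltx; rewrite -eqr // sqj; last lia.
  by congr T; lia.
(* Once the copy starts, every comparison succeeds. Since [i - s0 < b <= s0 + p - i], the left
   extension reaches [s0] by the time the square ends; it may go beyond. *)
have later r : r <= s0 + p - i ->
    let: (m, l) := track T i st (i + p + r) in m = r /\ minn r (i - s0) <= l <= r.
  elim: r => [|r IH] ler; first by rewrite addn0 start; lia.
  rewrite addnS /=; move/(_ ltac:(lia)): IH.
  case: (track T i st (i + p + r)) => m l [-> bdl].
  have -> : st <= i + p + r by lia.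
  rewrite -sqj ?eqxx //=; split; first lia.
  case: (eqVneq l r) => [elr|nelr] /=; last lia.
  case: (ltnP r (i - s0)) => [ltr|ler']; last by do ?case: eqP => /=; lia.
  have -> : r < i by lia.
  have := sq (i - s0 - r.+1) ltac:(lia).
  have -> : s0 + (i - s0 - r.+1) = i - (r + 1) by lia.
  have -> : s0 + p + (i - s0 - r.+1) = i + p + r - r - (r + 1) by lia.
  by move=> ->; rewrite eqxx; lia.
have := later (s0 + p - i) (leqnn _).
have -> : i + p + (s0 + p - i) = s0 + p + p by lia.
rewrite /hit; case: (track _ _ _ _) => m l [-> /= bdl]; lia.
Qed.

End Track.

(** Task [(k, q, c)] takes care of the squares whose first half has the
    aligned block of length [2 ^ k] and index [q] as its first aligned block
    of that length, and whose period [p] satisfies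
    [(2 + c) * 2 ^ k <= p + 1 < (3 + c) * 2 ^ k]. *)
Definition first_pos (k q c : nat) : nat := (q + 2 + c) * 2 ^ k - 1.

(** * Assignment of squares to tasks *)

Definition task_state (E : eqType) (T : nat -> E) (k q c N : nat) : nat * nat :=
  track T (q * 2 ^ k) (first_pos k q c) N.

(** The lower bound is [first_pos k q c + 1], the number of letters read after the first relevant
    one. A square of this task starts at most at [q * 2 ^ k] and has [p + 1 < 4 * 2 ^ k], whence the
    upper bound. *)
Definition active (k q c N : nat) : bool :=
  (q + 2 + c) * 2 ^ k <= N < (q + 8) * 2 ^ k.

Definition task_hit (E : eqType) (T : nat -> E) (k q c N : nat) : bool :=
  active k q c N && hit (q * 2 ^ k) N (task_state T k q c N).

Lemma first_pos_gt k q c : q * 2 ^ k < first_pos k q c.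
Proof. by rewrite /first_pos; have := expn_gt0 2 k; nia. Qed.

(** Without a square in the first [n] letters, a new one ends exactly at [n.+1], so a hit need only
    be tested at that moment. *)
Lemma square_before_recP (E : eqType) (T : nat -> E) (n : nat) :
  ~ square_before T n ->
  square_before T n.+1 <-> exists k q c, c < 2 /\ task_hit T k q c n.+1.
Proof.
move=> nosq; split=> [[s0 [p [sq leN]]]|]; last first.
  move=> [k [q [c [ltc /andP[act]]]]]; apply: hit_square (first_pos_gt k q c) _.
  by move: act; rewrite /active /first_pos; lia.
have eN : s0 + p + p = n.+1.
  by apply/eqP; rewrite eqn_leq leN ltnNge; apply/negP=> ?; apply: nosq; exists s0, p.
have p_gt0 : 0 < p by case: sq.
have /andP[lo hi] := trunc_log_bounds (n := p.+1) (isT : 1 < 2) isT.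
have : 0 < trunc_log 2 p.+1 by rewrite trunc_log_gt0.
case: (trunc_log 2 p.+1) lo hi => // k; rewrite !expnS => lo hi _.
pose b := 2 ^ k; have b_gt0 : 0 < b by rewrite expn_gt0.
(* As [2 b <= p + 1 < 4 b], the quotient is 2 or 3 and selects the half of the period range; [q] is
   [s0 / b] rounded up. *)
pose c := (2 < p.+1 %/ b) : nat.
pose q := (s0 + (b - 1)) %/ b.
have [qlo qhi] : s0 <= q * b /\ q * b < s0 + b.
  by rewrite /q; have := divn_eq (s0 + (b - 1)) b; have := ltn_pmod (s0 + (b - 1)) b_gt0; lia.
have [clo chi] : (2 + c) * b <= p.+1 /\ p.+1 < (3 + c) * b.
  rewrite /c -/b in lo hi *; have := divn_eq p.+1 b; have := ltn_pmod p.+1 b_gt0.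
  by case: ltnP => /= ?; nia.
have ltc : c < 2 by rewrite /c; case: (2 < _).
exists k, q, c; split=> //; apply/andP; split.
  by rewrite /active -/b !mulnDl -eN; nia.
rewrite -eN /task_state; apply: (square_hit (b := b)) => //.
- by rewrite eN.
- by rewrite -/b; lia.
- exact: first_pos_gt.
- by rewrite /first_pos -/b !mulnDl; nia.
- by rewrite -/b; nia.
Qed.

(** * The program *)

Definition cell (x : nat) : expr := EFetch (EConst x).
Definition incr (e : expr) : expr := EBin OpAdd e (EConst 1).

(** Integer cells: 1 = a square has been found; 2 = number [n] of letters
    already read; 3 = block length [b]; 4 = block position [i]; 5 = address of
    the state [(m, l)] of the current task; 6 = [m]; 7 = [l]. Letter cell [j]
    holds the letter at position [j]. The address [8 * 2 ^ k * (2 q + 1) + 2 c]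
    determines the task [(k, q, c)], so every task has its own two cells and
    finds them zeroed. *)
Definition addr (k q c : nat) : nat := 8 * (2 * (q * 2 ^ k) + 2 ^ k) + 2 * c.

(** The letter comparison is evaluated even when a factor in front of it is 0; truncated subtraction
    keeps both addresses at most [n], so it cannot get stuck. *)
Definition extend_cmd : cmd :=
  CSeq (CStore (incr (cell 5))
    (EBin OpAdd (cell 7)
      (EBin OpMul (EBin OpEq (cell 7) (cell 6))
        (EBin OpMul (EBin OpLt (cell 6) (cell 4))
          (ELetterEq (EBin OpSub (cell 4) (incr (cell 6)))
             (EBin OpSub (EBin OpSub (cell 2) (cell 6)) (incr (cell 6))))))))
  (CSeq (CStore (cell 5) (incr (cell 6)))
  (CIf (EBin OpLt
          (EBin OpAdd (EBin OpAdd (EFetch (incr (cell 5))) (incr (cell 6)))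
             (cell 4))
          (EBin OpSub (cell 2) (cell 6)))
     CSkip (CStore (EConst 1) (EConst 1)))).

Definition reset_cmd : cmd :=
  CSeq (CStore (incr (cell 5)) (EConst 0)) (CStore (cell 5) (EConst 0)).

Definition load_cmd (c e : nat) : cmd :=
  CSeq (CStore (EConst 4)
    (EBin OpMul (EBin OpSub (EBin OpDiv (incr (cell 2)) (cell 3)) (EConst e))
       (cell 3)))
  (CSeq (CStore (EConst 5)
    (EBin OpAdd (EBin OpMul (EConst 8)
         (EBin OpAdd (EBin OpMul (EConst 2) (cell 4)) (cell 3)))
       (EConst (2 * c))))
  (CSeq (CStore (EConst 6) (EFetch (cell 5)))
        (CStore (EConst 7) (EFetch (incr (cell 5)))))).

(** Runs the task [(k, q, c)] where [b = 2 ^ k] and [q = (n + 1) / b - e]. *)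
Definition task_cmd (ce : nat * nat) : cmd :=
  CIf (EBin OpLt (incr (cell 2)) (EBin OpMul (EConst ce.2) (cell 3))) CSkip
    (CSeq (load_cmd ce.1 ce.2)
      (CIf (ELetterEq (cell 2) (EBin OpAdd (cell 4) (cell 6)))
         extend_cmd reset_cmd)).

(** With [e = (n + 1) / b - q], being active means [2 + c <= e < 8]: six tasks for [c = 0], five for
    [c = 1]. *)
Definition tasks : seq (nat * nat) :=
  [seq (0, e) | e <- iota 2 6] ++ [seq (1, e) | e <- iota 3 5].

Definition scale_cmd : cmd := foldr (fun ce => CSeq (task_cmd ce))
  (CStore (EConst 3) (EBin OpMul (cell 3) (EConst 2))) tasks.

(** This is [2 b <= n + 1]; for larger [b] no task is active. *)
Definition more_scales : expr :=
  EBin OpLt (EBin OpMul (cell 3) (EConst 2)) (EBin OpAdd (cell 2) (EConst 2)).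

Definition init_cmd : cmd :=
  CSeq (CRead (cell 2)) (CStore (EConst 3) (EConst 1)).

Definition verdict_cmd : cmd :=
  CSeq (CStore (EConst 2) (incr (cell 2)))
       (CStore (EConst 0) (EBin OpEq (cell 1) (EConst 0))).

(** Once cell 1 is set, cell 0 stays 0, as longer prefixes contain the same square. *)
Definition detector : cmd :=
  CIf (cell 1) CSkip
    (CSeq init_cmd (CSeq (CWhile more_scales scale_cmd) verdict_cmd)).

Fixpoint loop_free (c : cmd) : bool :=
  match c with
  | CSeq c1 c2 | CIf _ c1 c2 => loop_free c1 && loop_free c2
  | CWhile _ _ => false
  | _ => true
  end.

(** The value 0 for a loop is a placeholder: the bound is only applied to loop-free code. *)
Fixpoint max_cost (c : cmd) : nat :=
  match c with
  | CSkip => 1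
  | CStore e1 e2 | CCopyLetter e1 e2 => (ecost e1 + ecost e2).+1
  | CRead e => (ecost e).+1
  | CSeq c1 c2 => max_cost c1 + max_cost c2
  | CIf e c1 c2 => (ecost e + (max_cost c1 + max_cost c2)).+1
  | CWhile _ _ => 0
  end.

(** [2 * (q * 2 ^ k) + 2 ^ k] has 2-adic valuation [k] and odd part [2 q + 1]; [2 * c < 8] is the
    remainder of the address modulo 8. *)
Lemma addr_inj k q c k' q' c' : c < 2 -> c' < 2 ->
  addr k q c = addr k' q' c' -> [/\ k = k', q = q' & c = c'].
Proof.
have logE j r : logn 2 (2 * (r * 2 ^ j) + 2 ^ j) = j.
  rewrite mulnA -mulSnr lognM ?expn_gt0 // pfactorK // logn_coprime //.
  by rewrite coprime2n /= mul2n odd_double.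
move=> ltc ltc' e.
have e1 : 2 * (q * 2 ^ k) + 2 ^ k = 2 * (q' * 2 ^ k') + 2 ^ k'.
  by move: e; rewrite /addr; lia.
have ek : k = k' by rewrite -(logE k q) e1 logE.
subst k'; split=> //; last by move: e; rewrite /addr; lia.
by have := expn_gt0 2 k; nia.
Qed.

(** * Execution rules *)

Section Execution.

Variables (A : eqType) (space bits : nat) (a : A).
Implicit Types (st : state A) (e : expr) (Q : state A -> Prop).

Notation eval := (@eval A space bits).
Notation exec := (@exec A space bits a).

Lemma exec_max_cost c st t st' : exec c st t st' -> loop_free c -> t <= max_cost c.
Proof.
elim=> //= {c st t st'} [c1 c2 st t1 st1 t2 st2 _ IH1 _ IH2|e c1 c2 st v t st1 _ _ IH].
  by case/andP=> /IH1 ? /IH2 ?; exact: leq_add.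
by case/andP=> l1 l2; move: IH; case: (v != 0) => /=; lia.
Qed.

Definition ends (c : cmd) st Q : Prop :=
  exists t st', exec c st t st' /\ Q st'.

Lemma ends_weak c st Q Q' : (forall st', Q st' -> Q' st') -> ends c st Q -> ends c st Q'.
Proof. by move=> sub [t [st' [E q]]]; exists t, st'; split; [|exact: sub]. Qed.

Lemma ends_skip st Q : Q st -> ends CSkip st Q.
Proof. by move=> q; exists 1, st; split=> //; constructor. Qed.

Lemma ends_seq c1 c2 st Q : ends c1 st (fun st1 => ends c2 st1 Q) -> ends (CSeq c1 c2) st Q.
Proof.
move=> [t1 [st1 [E1 [t2 [st2 [E2 q]]]]]]; exists (t1 + t2), st2; split=> //.
exact: exec_Seq E1 E2.
Qed.

Lemma ends_if v e c1 c2 st Q : eval st e = Some v ->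
  ends (if v != 0 then c1 else c2) st Q -> ends (CIf e c1 c2) st Q.
Proof.
move=> ev [t [st' [E q]]]; exists (ecost e + t).+1, st'; split=> //.
exact: exec_If ev E.
Qed.

Lemma ends_store i v e1 e2 st Q :
  eval st e1 = Some i -> i < space -> eval st e2 = Some v ->
  Q (State (upd (words st) i v) (letters st)) -> ends (CStore e1 e2) st Q.
Proof. by move=> ev1 lti ev2 q; do 2!eexists; split; first exact: exec_Store ev1 _ ev2. Qed.

Lemma ends_read i e st Q : eval st e = Some i -> i < space ->
  Q (State (words st) (upd (letters st) i (Some a))) -> ends (CRead e) st Q.
Proof. by move=> ev1 lti q; do 2!eexists; split; first exact: exec_Read ev1 _. Qed.

Lemma eval_const st v : v < 2 ^ bits -> eval st (EConst v) = Some v.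
Proof. by rewrite /= /fit => ->. Qed.

Lemma eval_fetch st e i v : eval st e = Some i -> i < space -> words st i = v ->
  eval st (EFetch e) = Some v.
Proof. by rewrite /= => -> /= lti <-; rewrite /fetch_word lti. Qed.

Lemma eval_bin st o e1 e2 x y v : eval st e1 = Some x -> eval st e2 = Some y ->
  binop_sem o x y = v -> v < 2 ^ bits -> eval st (EBin o e1 e2) = Some v.
Proof. by rewrite /= => -> -> -> ltv; rewrite /fit ltv. Qed.

Lemma eval_letter_eq st e1 e2 x y (b b' : A) :
  eval st e1 = Some x -> eval st e2 = Some y -> x < space -> y < space ->
  letters st x = Some b -> letters st y = Some b' -> 1 < 2 ^ bits ->
  eval st (ELetterEq e1 e2) = Some (b == b' : nat).
Proof.
rewrite /= => -> -> ltx lty /=; rewrite /fetch_letter ltx lty => -> -> bnd.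
by rewrite /fit ifT //; case: (b == b') => //; exact: ltnW.
Qed.

End Execution.

Arguments ends_store {A space bits a} i v {e1 e2 st Q}.
Arguments ends_read {A space bits a} i {e st Q}.
Arguments ends_if {A space bits a} v {e c1 c2 st Q}.
Arguments eval_const {A space bits st}.
Arguments eval_fetch {A space bits st e i v}.
Arguments eval_bin {A space bits st o e1 e2} x y {v}.
Arguments eval_letter_eq {A space bits st e1 e2} x y {b b'}.

Ltac eval_tac :=
  rewrite ?/cell ?/incr;
  match goal with
  | |- eval _ _ _ (EConst _) = _ => apply: eval_const; lia
  | |- eval _ _ _ (EFetch _) = _ =>
      eapply eval_fetch; [eval_tac | lia | first [eassumption | reflexivity]]
  | |- eval _ _ _ (EBin _ _ _) = _ =>
      eapply eval_bin; [eval_tac | eval_tac | first [reflexivity | rewrite /=; lia] | rewrite /=; lia]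
  end.

(** * The memory invariant *)

Section Memory.

Variables (A : eqType) (s : seq A) (n : nat).

(** The memory while letter [n] is being processed, once the tasks in [done]
    have taken it into account; nothing is said about expired tasks. *)
Definition memory (done : nat -> nat -> nat -> bool) (st : state A) : Prop :=
  [/\ words st 2 = n,
      forall k q c, c < 2 -> n + done k q c < (q + 8) * 2 ^ k ->
        let ml := task_state (onth s) k q c (n + done k q c) in
        words st (addr k q c) = ml.1 /\ words st (addr k q c).+1 = ml.2,
      words st 1 != 0 <-> exists k q c,
        [/\ c < 2, done k q c & task_hit (onth s) k q c n.+1] &
      forall j, j <= n -> letters st j = onth s j].

(** Declaring inactive tasks done is free: an expired one carries no claim, one not yet started is
    in state [(0, 0)] before and after letter [n], and neither hits. *)
Lemma memory_mono (done done' : nat -> nat -> nat -> bool) st :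
  (forall k' q' c', done k' q' c' -> done' k' q' c') ->
  (forall k' q' c', c' < 2 -> active k' q' c' n.+1 -> done' k' q' c' ->
    done k' q' c') ->
  memory done st -> memory done' st.
Proof.
move=> sub sup [w2 slots found lets]; split=> // [k' q' c' ltc'|].
  case d': (done' k' q' c'); last first.
    have d : done k' q' c' = false by apply/negbTE/negP => /sub; rewrite d'.
    by have := slots k' q' c' ltc'; rewrite d.
  case d: (done k' q' c'); first by have := slots k' q' c' ltc'; rewrite d.
  rewrite addn1 => ltn8.
  have lef : n.+1 <= first_pos k' q' c'.
    have : ~~ active k' q' c' n.+1 by apply/negP=> /sup; rewrite d d' => /(_ ltc' isT).
    by rewrite /active ltn8 andbT -ltnNge /first_pos; lia.
  have := slots k' q' c' ltc'; rewrite d addn0 => /(_ (ltnW ltn8)).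
  by rewrite /task_state !track_idle // ltnW.
split=> [/found[k' [q' [c' [ltc' d hit]]]]|[k' [q' [c' [ltc' d' hit]]]]].
  by exists k', q', c'; split=> //; exact: sub.
by apply/found; exists k', q', c'; split=> //; apply: sup => //; case/andP: hit.
Qed.

Lemma memory_cell3 done st v : memory done st ->
  memory done (State (upd (words st) 3 v) (letters st)).
Proof.
move=> [w2 slots found lets]; split=> //= k' q' c' ltc' /(slots k' q' c' ltc').
by rewrite /upd !ifN_eq // /addr; have := expn_gt0 2 k'; lia.
Qed.

End Memory.

(** * Correctness of one block length *)

Section Task.

Variables (A : eqType) (s : seq A) (space bits : nat) (a : A) (n k : nat).
Hypotheses (ltn : n < size s) (le_kn : 2 ^ k <= n.+1)
  (le_space : 16 * n + 32 <= space) (le_bits : 32 * n + 64 <= 2 ^ bits).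

Notation ends := (@ends A space bits a).
Notation memory := (@memory A s n).
Notation b := (2 ^ k).

Lemma load_spec c e q st : c < 2 -> 2 + c <= e < 8 ->
  words st 2 = n -> words st 3 = b -> n.+1 %/ b = q + e ->
  ends (load_cmd c e) st (fun st' =>
    [/\ words st' 4 = q * b, words st' 5 = addr k q c,
        words st' 6 = words st (addr k q c),
        words st' 7 = words st (addr k q c).+1 &
        (forall j, (j < 4) || (8 <= j) -> words st' j = words st j) /\
        letters st' = letters st]).
Proof.
move=> ltc lte w2 w3 eQ; have b_gt0 : 0 < b by rewrite expn_gt0.
have leqb : (q + e) * b <= n.+1 by rewrite -eQ leq_divM.
have ltqb : q * b + e * b <= n.+1 by rewrite -mulnDl.
have lti : q * b + 2 * b <= n.+1 by nia.
have le_qe : q + e <= n.+1 by nia.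
(* Linear space comes from here: [q * b + 2 * b <= n + 1] keeps the address linear in [n]. *)
have ad8 : 8 <= addr k q c < 16 * n + 28 by rewrite /addr; lia.
apply/ends_seq/(ends_store 4 (q * b)); [by eval_tac | lia | | ].
  apply: (eval_bin q b); [|by eval_tac|by []|lia].
  apply: (eval_bin (q + e) e); [|by eval_tac|by rewrite /= addnK|lia].
  by apply: (eval_bin n.+1 b); [by eval_tac|by eval_tac|by []|lia].
set st1 := State _ _.
have [w13 w14] : words st1 3 = b /\ words st1 4 = q * b by [].
apply/ends_seq/(ends_store 5 (addr k q c)); [by eval_tac | lia | by rewrite /addr; eval_tac | ].
set st2 := State _ _.
have w25 : words st2 5 = addr k q c by [].
apply/ends_seq/(ends_store 6 (words st (addr k q c))); [by eval_tac | lia | | ].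
  apply: eval_fetch; [by eval_tac | lia | ].
  by rewrite /= /upd !ifN_eq; lia.
set st3 := State _ _.
have w35 : words st3 5 = addr k q c by [].
apply: (ends_store 7 (words st (addr k q c).+1)); [by eval_tac | lia | | ].
  apply: (eval_fetch (i := (addr k q c).+1)); [by eval_tac | lia | ].
  by rewrite /= /upd !ifN_eq; lia.
split=> //=; split=> // j ltj.
by rewrite /upd !ifN_eq; lia.
Qed.


Lemma onth_some j : j <= n -> exists x, onth s j = Some x.
Proof.
move=> lej; have := onthTE s j; rewrite (leq_ltn_trans lej ltn).
by case: (onth s j) => // x _; exists x.
Qed.

Lemma eval_onth_eq e1 e2 x y st : (forall j, j <= n -> letters st j = onth s j) ->
  x <= n -> y <= n -> eval space bits st e1 = Some x -> eval space bits st e2 = Some y ->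
  eval space bits st (ELetterEq e1 e2) = Some (onth s x == onth s y : nat).
Proof.
move=> lets lex ley ev1 ev2.
have [u eu] := onth_some lex; have [v ev] := onth_some ley.
have -> : (onth s x == onth s y) = (u == v) by rewrite eu ev.
by apply: (eval_letter_eq x y); rewrite ?lets //; lia.
Qed.

Lemma extend_spec i ad m l st :
  words st 2 = n -> words st 4 = i -> words st 5 = ad -> words st 6 = m ->
  words st 7 = l -> (forall j, j <= n -> letters st j = onth s j) ->
  i <= n -> m <= n -> l <= m -> 8 <= ad < 16 * n + 28 ->
  let l' := l + (l == m) *
     ((m < i) * (onth s (i - (m + 1)) == onth s (n - m - (m + 1)))) in
  ends extend_cmd st (fun st' =>
    [/\ words st' ad = m + 1, words st' ad.+1 = l',
        words st' 1 = (if hit i n.+1 (m + 1, l') then 1 else words st 1),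
        forall j, (j != 1) && (j != ad) && (j != ad.+1) ->
          words st' j = words st j &
        letters st' = letters st]).
Proof.
move=> w2 w4 w5 w6 w7 lets lei lem lel bad l'.
have lel' : l <= l' <= l + 1.
  by rewrite /l'; case: (l == m); case: (m < i); case: (_ == _ :> option A); lia.
apply/ends_seq/(ends_store ad.+1 l'); [by eval_tac | lia | | ].
  apply: eval_bin; [by eval_tac | | by [] | lia].
  apply: eval_bin; [by eval_tac | | by [] | by rewrite /=; lia].
  apply: eval_bin; [by eval_tac | | by [] | by rewrite /=; lia].
  by apply: eval_onth_eq => //; [lia | lia | eval_tac | eval_tac].
set st1 := State _ _.
have [w12 w14 w15 w16] :
    [/\ words st1 2 = n, words st1 4 = i, words st1 5 = ad & words st1 6 = m].
  by rewrite /= /upd !ifN_eq; try lia; split.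
apply/ends_seq/(ends_store ad (m + 1)); [by eval_tac | lia | by eval_tac | ].
set st2 := State _ _.
have [w22 w24 w25 w26] :
    [/\ words st2 2 = n, words st2 4 = i, words st2 5 = ad & words st2 6 = m].
  by rewrite /st2 /= {1 3 5 7}/upd !ifN_eq; try lia; split.
have w2ad : words st2 ad.+1 = l' by rewrite /= /upd ifN_eq ?eqxx //; lia.
apply: (ends_if (l' + (m + 1) + i < n - m)).
  apply: eval_bin; [ | by eval_tac | by [] | by rewrite /=; lia].
  apply: eval_bin; [ | by eval_tac | by [] | by rewrite /=; lia].
  apply: eval_bin; [ | by eval_tac | by [] | by rewrite /=; lia].
  by apply: (eval_fetch (i := ad.+1)) => //; [eval_tac | lia].
have -> : hit i n.+1 (m + 1, l') = ~~ (l' + (m + 1) + i < n - m).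
  by rewrite /hit /= -leqNgt addn1 subSS.
case: (_ < _) => /=; last first.
  apply: (ends_store 1 1); [by eval_tac | lia | by eval_tac | ].
  split=> //=.
  - by rewrite /upd eqxx ifN_eq //; lia.
  - by rewrite {1}/upd ifN_eq //; lia.
  - by move=> j /andP[/andP[j1 j2] j3]; rewrite /upd !ifN_eq.
apply: ends_skip; split=> //=.
- by rewrite /upd eqxx.
- by rewrite /upd !ifN_eq //; lia.
- by move=> j /andP[/andP[j1 j2] j3]; rewrite /upd !ifN_eq.
Qed.

Lemma reset_spec ad st : words st 5 = ad -> 8 <= ad < 16 * n + 28 ->
  ends reset_cmd st (fun st' =>
    [/\ words st' ad = 0, words st' ad.+1 = 0,
        forall j, (j != ad) && (j != ad.+1) -> words st' j = words st j &
        letters st' = letters st]).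
Proof.
move=> w5 bad.
apply/ends_seq/(ends_store ad.+1 0); [by eval_tac | lia | by eval_tac | ].
set st1 := State _ _.
have w15 : words st1 5 = ad by rewrite /= /upd ifN_eq //; lia.
apply: (ends_store ad 0); [by eval_tac | lia | by eval_tac | ].
split=> //=; first by rewrite /upd eqxx.
  by rewrite /upd eqxx ifN_eq //; lia.
by move=> j /andP[j1 j2]; rewrite /upd !ifN_eq.
Qed.

Lemma task_spec c e done st : c < 2 -> 2 + c <= e < 8 ->
  words st 3 = b -> memory done st ->
  (forall q, q + e = n.+1 %/ b -> ~~ done k q c) ->
  ends (task_cmd (c, e)) st (fun st' => words st' 3 = b /\
    memory (fun k' q' c' => done k' q' c' ||
      [&& k' == k, q' + e == n.+1 %/ b & c' == c]) st').
Proof.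
move=> ltc bde w3 mem ndone; have [w2 slots found lets] := mem.
have b_gt0 : 0 < b by rewrite expn_gt0.
have := leq_divM n.+1 b; have := ltn_ceil n.+1 b_gt0 => ltQ leQ.
have leeb : e * b <= 7 * n.+1 by rewrite leq_mul //; lia.
rewrite /task_cmd /fst /snd; apply: (ends_if (n.+1 < e * b)).
  apply: (eval_bin n.+1 (e * b)) => //; last by rewrite /=; lia.
    by eval_tac.
  by eval_tac.
(* If [n + 1 < e * b], no [q] satisfies [q + e = (n + 1) / b], so skipping marks nothing new as
   done. *)
case: ltnP => /= [ltn1|leeb'].
  apply: ends_skip; split=> //; apply: memory_mono mem => [k' q' c' ->//|k' q' c' _ _].
  by case: and3P => [[/eqP ? /eqP eq _]|_]; [nia | rewrite orbF].
have leeQ : e <= n.+1 %/ b by rewrite leq_divRL.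
pose q := n.+1 %/ b - e.
have eQ : n.+1 %/ b = q + e by rewrite subnK.
have act : active k q c n.+1 by rewrite /active; nia.
have isq q' : (q' + e == n.+1 %/ b) = (q' == q) by rewrite eQ eqn_add2r.
have nd : done k q c = false by apply/negbTE/ndone.
apply/ends_seq; apply: ends_weak (load_spec ltc bde w2 w3 eQ) => st1.
case=> [w14 w15 w16 w17 [fr1 lets1]].
have [] := slots k q c ltc; rewrite nd addn0.
  by move: act; rewrite /active; lia.
rewrite -w16 -w17.
have w12 : words st1 2 = n by rewrite fr1.
set ad := addr k q c in w15 *.
have lti2 : q * b + 2 * b <= n.+1 by move: act; rewrite /active; nia.
have bad : 8 <= ad < 16 * n + 28 by rewrite /ad /addr; lia.
have finish st' : let ml := task_state (onth s) k q c n.+1 in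
    words st' ad = ml.1 -> words st' ad.+1 = ml.2 ->
    words st' 1 = (if hit (q * b) n.+1 ml then 1 else words st1 1) ->
    (forall j, (j != 1) && (j != ad) && (j != ad.+1) -> words st' j = words st1 j) ->
    letters st' = letters st1 ->
    words st' 3 = b /\ memory (fun k' q' c' => done k' q' c' ||
      [&& k' == k, q' + e == n.+1 %/ b & c' == c]) st'.
  move=> ml wm wl w1 fr lets'; split; first by rewrite fr ?fr1 //; lia.
  have hitE : task_hit (onth s) k q c n.+1 = hit (q * b) n.+1 ml.
    by rewrite /task_hit act.
  split.
  - by rewrite fr //; lia.
  - move=> k' q' c' ltc'; rewrite isq; case: and3P => [[/eqP-> /eqP-> /eqP->]|ne].
      by rewrite orbT addn1.
    rewrite orbF => /(slots k' q' c' ltc'); rewrite -!fr1; try by rewrite /addr; lia.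
    have ne' : addr k' q' c' != ad.
      by apply/eqP => /addr_inj[] // *; apply: ne; split; apply/eqP.
    have ne1 : addr k' q' c' != ad.+1 by move: ne'; rewrite /ad /addr; lia.
    have ne2 : (addr k' q' c').+1 != ad by move: ne'; rewrite /ad /addr; lia.
    by rewrite !fr // ?eqSS ?ne' ?ne1 ?ne2 /addr; lia.
  - rewrite w1; case hitF: (hit _ _ _).
      split=> // _; exists k, q, c; split=> //; first by rewrite isq !eqxx orbT.
      by rewrite hitE hitF.
    rewrite fr1 //; split=> [/found[k' [q' [c' [ltc' d hit']]]]|].
      by exists k', q', c'; rewrite d.
    move=> [k' [q' [c' [ltc' d hit']]]]; apply/found; exists k', q', c'; split=> //.
    move: d; rewrite isq; case: and3P => [[/eqP ek /eqP eq /eqP ec]|_].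
      by move: hit'; rewrite ek eq ec hitE hitF.
    by rewrite orbF.
  - by move=> j lej; rewrite lets' lets1 lets.
have := track_sound (onth s) n (first_pos_gt k q c).
have lef : first_pos k q c <= n by move: act; rewrite /active /first_pos; lia.
have ltif := first_pos_gt k q c.
move: finish; rewrite /task_state [track _ _ _ n.+1]/= lef /=.
case: (track _ _ _ n) => m l finish /= [lem lelm _ _ _] w16' w17'.
have {}lem : m + first_pos k q c <= n by case/orP: lem => [/eqP->|].
have lets1' j : j <= n -> letters st1 j = onth s j by rewrite lets1; exact: lets.
apply: (ends_if (onth s n == onth s (q * b + m) : nat)).
  by apply: eval_onth_eq; [exact: lets1' | lia | lia | eval_tac | eval_tac].
move: finish; case: (_ == _ :> option A) => finish.
  have := @extend_spec (q * b) ad m l st1 w12 w14 w15 w16' w17' lets1'.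
  move=> /(_ ltac:(lia) ltac:(lia) lelm bad); apply: ends_weak => st' [*].
  exact: finish.
apply: ends_weak (reset_spec w15 bad) => st' [wm wl fr lets'].
apply: finish => //.
  by rewrite fr /hit /= ?ifF //; lia.
by move=> j /andP[/andP[_ ? ?]]; apply: fr; apply/andP.
Qed.

Definition seen (l : seq (nat * nat)) (k' q' c' : nat) : bool :=
  (k' < k) ||
  has (fun ce => [&& k' == k, q' + ce.2 == n.+1 %/ b & c' == ce.1]) l.

(** The accumulator [l] lists the tasks already run, latest first; uniqueness ensures that no task
    processes letter [n] twice. *)
Lemma tasks_spec tail todo l st Q :
  all (fun ce => (ce.1 < 2) && (2 + ce.1 <= ce.2 < 8)) todo ->
  uniq (catrev todo l) -> words st 3 = b -> memory (seen l) st ->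
  (forall st', words st' 3 = b -> memory (seen (catrev todo l)) st' ->
    ends tail st' Q) ->
  ends (foldr (fun ce => CSeq (task_cmd ce)) tail todo) st Q.
Proof.
elim: todo l st => [|[c e] todo IH] l st /= => [_ _ w3 mem|]; first exact.
move=> /andP[/andP[ltc bde] ok] uni w3 mem next.
have := uni; rewrite catrevE cat_uniq => /and3P[_ _ /= /andP[nl _]].
apply/ends_seq; apply: ends_weak (task_spec ltc bde w3 mem _) => [st' [w3' mem']|].
  apply: IH ok uni w3' _ next; apply: memory_mono mem' => [k' q' c'|k' q' c' _ _];
  by rewrite /seen /= -orbA [has _ _ || _]orbC.
move=> q eQ; rewrite /seen ltnn; apply/hasPn => -[c' e'] lce /=; rewrite eqxx -eQ.
rewrite eqn_add2l /=; apply/andP => -[/eqP e1 /eqP e2].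
by move: nl; rewrite e2 -e1 lce.
Qed.

Lemma active_seen q c : c < 2 -> active k q c n.+1 -> seen (catrev tasks [::]) k q c.
Proof.
move=> ltc /andP[act1 act2]; apply/orP; right.
have b_gt0 : 0 < b by rewrite expn_gt0.
have leQ : q + 2 + c <= n.+1 %/ b by rewrite leq_divRL.
have ltQ : n.+1 %/ b < q + 8 by rewrite ltn_divLR.
apply/hasP; exists (c, n.+1 %/ b - q); last by rewrite /= !eqxx subnKC ?eqxx //; lia.
have : 2 + c <= n.+1 %/ b - q < 8 by lia.
move: (_ - q) => e; case: c ltc {act1 act2 leQ} => [|[|//]] _;
by do 8?[case: e => [|e] //].
Qed.

Lemma scale_spec st : words st 3 = b ->
  memory (fun k' _ _ => k' < k) st ->
  ends scale_cmd st (fun st' => words st' 3 = 2 ^ k.+1 /\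
    memory (fun k' _ _ => k' < k.+1) st').
Proof.
move=> w3 mem; apply: (tasks_spec (l := [::])) => //.
  by apply: memory_mono mem => k' q' c'; rewrite /seen orbF.
move=> st1 w13 mem1.
apply: (ends_store 3 (b * 2)); [by eval_tac | lia | by eval_tac | ].
split; first by rewrite /= expnSr.
apply/memory_cell3/(memory_mono _ _ mem1) => [k' q' c'|k' q' c' ltc' act].
  by rewrite ltnS => /orP[/ltnW//|/hasP[ce _ /and3P[/eqP->]]].
rewrite ltnS leq_eqVlt => /orP[/eqP ek|ltk]; last by rewrite /seen ltk.
by subst k'; exact: active_seen.
Qed.

End Task.

(** * Time per letter and the whole run *)

Section Run.

Variables (A : eqType) (s : seq A) (space bits : nat).

Notation T := (onth s).

Definition scale_time : nat := max_cost scale_cmd + (ecost more_scales).+1.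

Definition letter_time (N : nat) : nat :=
  ecost (cell 1) + max_cost init_cmd + max_cost verdict_cmd +
  (trunc_log 2 N).+1 * scale_time + 2.

Section Letter.

Variables (a : A) (n : nat).
Hypotheses (ltn : n < size s) (eqa : T n = Some a)
  (le_space : 16 * n + 32 <= space) (le_bits : 32 * n + 64 <= 2 ^ bits).

Notation exec := (@exec A space bits a).
Notation ends := (@ends A space bits a).

Lemma ends_time c st Q : ends c st Q -> loop_free c ->
  exists t st', exec c st t st' /\ t <= max_cost c /\ Q st'.
Proof.
move=> [t [st' [E q]]] lf; exists t, st'; split=> //; split=> //.
exact: exec_max_cost E lf.
Qed.

Lemma loop_spec r k st : k + r = trunc_log 2 n.+1 -> words st 3 = 2 ^ k ->
  memory s n (fun k' _ _ => k' < k) st ->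
  exists t st', exec (CWhile more_scales scale_cmd) st t st' /\
    t <= r.+1 * scale_time /\ memory s n (fun _ _ _ => true) st'.
Proof.
elim: r k st => [|r IH] k st ek w3 mem; have [w2 _ _ _] := mem;
  have /andP[lo hi] := trunc_log_bounds (n := n.+1) (isT : 1 < 2) isT;
  have lek : 2 ^ k <= n.+1 by (apply: (leq_trans _ lo); rewrite leq_exp2l //; lia).
  have ev : eval space bits st more_scales = Some 0.
    apply: (eval_bin (2 ^ k * 2) (n + 2)); [by eval_tac | by eval_tac | | lia].
    by move: hi; rewrite -ek addn0 expnS /=; lia.
  exists (ecost more_scales).+1, st; split; first exact: exec_While_end.
  split; first by rewrite mul1n leq_addl.
  (* On exit [n + 1 < 2 * 2 ^ k], so the tasks of all remaining scales are inactive and may be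
     declared done. *)
  apply: memory_mono mem => // k' q' c' ltc' act _; rewrite ltnNge.
  apply/negP => lekk; move: act hi => /andP[act _]; rewrite -ek addn0 expnS.
  have : 2 ^ k <= 2 ^ k' by rewrite leq_exp2l.
  by nia.
have ltb : 2 ^ k.+1 <= n.+1.
  by apply: (leq_trans _ lo); rewrite leq_exp2l // -ek addnS ltnS leq_addr.
have ev : eval space bits st more_scales = Some 1.
  apply: (eval_bin (2 ^ k * 2) (n + 2)); [by eval_tac | by eval_tac | | lia].
  by move: ltb; rewrite expnS /=; lia.
have [|t1 [st1 [E1 [le1 [w13 mem1]]]]] := ends_time (scale_spec a ltn lek le_space le_bits w3 mem).
  by [].
have [|t2 [st2 [E2 [le2 mem2]]]] := IH k.+1 st1 _ w13 mem1; first by rewrite -ek addnS.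
exists (ecost more_scales + t1 + t2).+1, st2; split; first exact: exec_While_loop ev _ E1 E2.
split=> //; rewrite mulSn; move: le1 le2; rewrite /scale_time; lia.
Qed.

(** Invariant between letters. After a detection only the verdict is kept: completeness of the
    matcher relies on the text being squarefree so far. *)
Definition ready (N : nat) (st : state A) : Prop :=
  if words st 1 == 0 then
    [/\ ~ square_before T N, words st 2 = N,
        forall k q c, c < 2 -> N < (q + 8) * 2 ^ k ->
          words st (addr k q c) = (task_state T k q c N).1 /\
          words st (addr k q c).+1 = (task_state T k q c N).2 &
        forall j, j < N -> letters st j = T j]
  else square_before T N /\ words st 0 = 0.

Lemma letter_spec st : ready n st ->
  exists t st', [/\ exec detector st t st', t <= letter_time n.+1,
    ready n.+1 st' & words st' 0 != 0 <-> ~ square_before T n.+1].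
Proof.
rewrite /ready; case: eqP => [w1 [nosq w2 slots lets] | /eqP w1 [sq w0]]; last first.
  have sq' : square_before T n.+1.
    by case: sq => i [p [sqip lep]]; exists i, p; split=> //; exact: leqW.
  exists (ecost (cell 1) + 1).+1, st; split.
  - apply: (exec_If (v := words st 1)); last by rewrite w1; exact: exec_Skip.
    by eval_tac.
  - by rewrite /letter_time; lia.
  - by rewrite (negbTE w1).
  - by rewrite w0.
have init : ends init_cmd st (fun st1 => words st1 3 = 2 ^ 0 /\
    memory s n (fun k _ _ => k < 0) st1).
  apply/ends_seq/(ends_read n); [by eval_tac | lia | ].
  apply: (ends_store 3 1); [by eval_tac | lia | by eval_tac | ].
  split=> //; apply: memory_cell3; split=> //= [k q c||j].
  - by rewrite addn0; exact: slots.
  - by rewrite w1; split=> // -[k [q [c []]]].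
  rewrite leq_eqVlt /upd => /orP[/eqP->|ltj]; first by rewrite eqxx eqa.
  by rewrite ifN_eq ?lets // ltn_eqF.
have [|t1 [st1 [E1 [le1 [w13 mem1]]]]] := ends_time init; first by [].
have [t2 [st2 [E2 [le2 mem2]]]] := loop_spec (add0n _) w13 mem1.
have [w22 slots2 found2 lets2] := mem2.
have : ends verdict_cmd st2 (fun st3 => ready n.+1 st3 /\
    (words st3 0 != 0 <-> ~ square_before T n.+1)).
  apply/ends_seq/(ends_store 2 n.+1); [by eval_tac | lia | by eval_tac | ].
  apply: (ends_store 0 (words st2 1 == 0)); [by eval_tac | lia | | ].
    apply: eval_bin; [by eval_tac | by eval_tac | by [] | ].
    by rewrite /=; case: (_ == 0); lia.
  have sqE : square_before T n.+1 <-> words st2 1 != 0.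
    rewrite square_before_recP // found2.
    split=> -[k [q [c]]] => [[ltc hit]|[ltc _ hit]]; exists k, q, c; last by split.
    by split.
  rewrite /ready [X in X == 0]/= [words _ 0]/=; case: eqP sqE => /= [w1'|w1'] sqE.
    have nosq' : ~ square_before T n.+1 by move/sqE.
    split=> //; split=> //= k q c ltc.
      have := slots2 k q c ltc; rewrite addn1 => slots2' /slots2'.
      by rewrite /upd !ifN_eq // /addr; have := expn_gt0 2 k; lia.
  have sq' : square_before T n.+1 by apply/sqE.
  by split; [split | split=> // /(_ sq')].
move=> /ends_time[|t3 [st3 [E3 [le3 [rdy vok]]]]]; first by [].
exists (ecost (cell 1) + (t1 + (t2 + t3))).+1, st3; split=> //.
  apply: (exec_If (v := words st 1)); first by eval_tac.
  by rewrite w1 /=; apply: exec_Seq E1 _; apply: exec_Seq E2 E3.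
by move: le1 le2 le3; rewrite /letter_time; lia.
Qed.

End Letter.

Lemma run_spec pre suf st : s = pre ++ suf -> ready (size pre) st ->
  16 * size s + 32 <= space -> 32 * size s + 64 <= 2 ^ bits ->
  exists t vs, [/\ run space bits detector st suf t vs,
    t <= size suf * letter_time (size s) &
    forall i, i < size suf ->
      (nth false vs i <-> ~ square_before T (size pre + i).+1)].
Proof.
move=> + + le_space le_bits.
elim: suf pre st => [|a suf IH] pre st es rdy.
  by exists 0, [::]; split=> //; exact: run_nil.
have szs : size s = size pre + (size suf).+1 by rewrite es size_cat.
have eqa : T (size pre) = Some a by rewrite es onth_cat ltnn subnn.
have ltn : size pre < size s by lia.
have les : 16 * size pre + 32 <= space by lia.
have leb : 32 * size pre + 64 <= 2 ^ bits by lia.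
have [t1 [st1 [E1 le1 rdy1 v1]]] := letter_spec ltn eqa les leb rdy.
have [||t2 [vs [E2 le2 v2]]] := IH (rcons pre a) st1; rewrite ?cat_rcons ?size_rcons //.
exists (t1 + t2), ((words st1 0 != 0) :: vs); split; first exact: run_cons E1 E2.
  rewrite /= mulSn leq_add // (leq_trans le1) // /letter_time.
  by rewrite leq_add2r leq_add2l leq_mul2r ltnS leq_trunc_log ?orbT.
case=> [_|i] /=; first by rewrite addn0.
by rewrite ltnS => /v2; rewrite size_rcons addSnnS.
Qed.

End Run.

(** * Asymptotic bounds *)

Theorem theorem1 :
  exists (p : cmd) (time space bits : nat -> nat),
    bigO time (fun n => n * trunc_log 2 n) /\
    bigO space (fun n => n) /\
    bigO bits (fun n => trunc_log 2 n) /\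
    forall (A : eqType) (s : seq A),
      exists (t : nat) (vs : seq bool),
        run (space (size s)) (bits (size s)) p (init_state A) s t vs /\
        t <= time (size s) /\
        forall i : nat, i < size s ->
          (nth false vs i <-> squarefree (take i.+1 s)).
Proof.
(* The space holds all letters and state cells; the word size is chosen so that
   [32 * n + 64 <= 2 ^ bits]. *)
exists detector, (fun n => n * letter_time n), (fun n => 16 * n + 32),
  (fun n => trunc_log 2 n + 8).
have log_gt0 n : 2 <= n -> 0 < trunc_log 2 n by rewrite trunc_log_gt0.
split; last split; last split.
- exists (letter_time 2 + scale_time), 2 => n le2n; have := log_gt0 n le2n.
  rewrite mulnCA leq_mul2l /letter_time => lg; apply/orP; right.
  by rewrite trunc_lognn //; nia.
- by exists 48, 1 => n; lia.
- by exists 9, 2 => n /log_gt0; lia.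
move=> A s.
have [|||t [vs [E le v]]] := @run_spec A s (16 * size s + 32) (trunc_log 2 (size s) + 8)
    [::] s (init_state A) erefl.
- rewrite /ready /=; split=> // -[i [p [[p_gt0 _]]]]; lia.
- by [].
- have : size s < 2 ^ (trunc_log 2 (size s)).+1 by exact: trunc_log_ltn.
  rewrite expnS expnD; have -> : 2 ^ 8 = 256 by [].
  lia.
exists t, vs; split=> //; split=> // i lti.
by rewrite v // squarefree_takeP.
Qed.
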